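(* Let $(X,\nu)$ be a standard Borel space with a non-atomic probability measure $\nu$, let $\alpha\in(0,1)$ and $\theta>-\alpha$, and let $a:X\to\mathbb{R}_+$ be a measurable function such that $\int_Xa(x)^\alpha\,d\nu(x)<\infty$. Let $\mu_a$ be the distribution of the functional $f_a(\eta)=\int_Xa\,d\eta$ with respect to $\bar P_{\alpha,\theta}$, and let $\nu_a$ be the distribution of the function $a$ with respect to $\nu$. Then $\mu_a$ and $\nu_a$ are related by the following integral identity, for $z\ge0$: 1) if $\theta\ne0$, $$\left(\int_{\mathbb{R}}(1+zu)^{-\theta}\,d\mu_a(u)\right)^{-\frac1\theta}=\left(\int_{\mathbb{R}}(1+zu)^\alpha\,d\nu_a(u)\right)^{\frac1\alpha};$$ 2) if $\theta=0$, $$\exp\left(\int_{\mathbb{R}}\log(1+zu)^\alpha\,d\mu_a(u)\right)=\int_{\mathbb{R}}(1+zu)^\alpha\,d\nu_a(u).$$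
   Context: Let $D^+$ be the cone of finite positive discrete measures on $X$. Fix $c>0$. $P_\alpha$ is the law on $D^+$ of the standard $\alpha$-stable process on $(X,\nu)$ (the Lévy process with Lévy measure $\frac{c\alpha}{\Gamma(1-\alpha)}s^{-\alpha-1}ds$, $s>0$), characterized by $$\mathbb{E}_\alpha\left[\exp\left(-\int_Xa\,d\eta\right)\right]=\exp\left(-c\int_Xa(x)^\alpha\,d\nu(x)\right)$$ for measurable $a:X\to\mathbb{R}_+$ with $\int_Xa^\alpha\,d\nu<\infty$. For $\theta>-\alpha$, $P_{\alpha,\theta}$ is the law with density $\frac{dP_{\alpha,\theta}}{dP_\alpha}(\eta)=\frac{c_{\alpha,\theta}}{\eta(X)^\theta}$, where $c_{\alpha,\theta}=c^{\theta/\alpha}\frac{\Gamma(\theta+1)}{\Gamma(\theta/\alpha+1)}$ is a normalizing constant. $\bar P_{\alpha,\theta}$ is the law of the normalized measure $\eta/\eta(X)$ when $\eta$ has law $P_{\alpha,\theta}$. $\log(1+zu)^\alpha$ means $\alpha\log(1+zu)$. *)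

(* Defs.v *)
From HB Require Import structures.
From mathcomp Require Import all_boot all_order all_algebra.
From mathcomp Require Import all_classical all_reals all_analysis.
From mathcomp Require Import measurable_realfun.

Set Implicit Arguments.
Unset Strict Implicit.
Unset Printing Implicit Defensive.

Import Order.TTheory GRing.Theory Num.Theory.
Import numFieldNormedType.Exports.

Local Open Scope classical_set_scope.
Local Open Scope ring_scope.
Local Open Scope ereal_scope.

(* X is measurably isomorphic to a Polish space with its Borel sigma-algebra;
   a complete pseudometric whose topology is Hausdorff is a complete metric. *)
Definition standard_borel (R : realType) d (X : measurableType d) : Prop :=
  exists T : completePseudoMetricType R,
    [/\ hausdorff_space T,
        exists2 D : set T, countable D & dense D
      & exists2 f : X -> T, bijective f &
          forall A : set X, measurable A <-> <<s @open T >> (f @` A)].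

Definition nonatomic d (X : measurableType d) (R : realType)
    (nu : {measure set X -> \bar R}) : Prop :=
  forall A, measurable A -> 0 < nu A ->
    exists B, [/\ measurable B, B `<=` A, 0 < nu B & nu B < nu A].

Section discrete_measures.
Context d (X : measurableType d) (R : realType).

(* Zero weights are allowed, so that sums with finitely many atoms, and the
   zero measure, are covered.  The equality is required on every set and not
   only on measurable ones: a measure of the library is a function on all
   sets, and this fixes its values, so that an element of [dmeasure] below is
   determined by its weights and atoms. *)
Definition finite_discrete (eta : set X -> \bar R) : Prop :=
  exists (x : nat -> X) (w : nat -> R),
    [/\ forall i, (0 <= w i)%R,
        \sum_(i <oo) (w i)%:E < +oo
      & forall A, eta A = \sum_(i <oo) (w i)%:E * \d_(x i) A].

Record dmeasure := DMeasure {
  dmeasure_val :> {measure set X -> \bar R} ;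
  dmeasureP : finite_discrete dmeasure_val }.

HB.instance Definition _ := gen_eqMixin dmeasure.
HB.instance Definition _ := gen_choiceMixin dmeasure.

Lemma finite_discrete0 : finite_discrete (@mzero _ X R).
Proof.
exists (fun=> point), (fun=> 0%R); split => //.
- by rewrite eseries0.
- by move=> A; rewrite eseries0// => i _ _; rewrite mul0e.
Qed.

HB.instance Definition _ := isPointed.Build dmeasure (DMeasure finite_discrete0).

Definition dmeasure_gen : set_system dmeasure :=
  \bigcup_(B in @measurable _ X)
    preimage_set_system [set: dmeasure] (fun eta => eta B)
      measurable.

HB.instance Definition _ := @isMeasurable.Build (dmeasure_gen.-sigma)%mdisp
  dmeasure <<s dmeasure_gen >> (@sigma_algebra0 _ setT dmeasure_gen)
  (@sigma_algebraC _ dmeasure_gen) (@sigma_algebra_bigcup _ setT dmeasure_gen).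

Lemma measurable_dmeasure_eval (B : set X) : measurable B ->
  measurable_fun [set: dmeasure] (fun eta : dmeasure => eta B).
Proof.
move=> mB _ Y mY; apply: sub_sigma_algebra.
by exists B => //; exists Y.
Qed.

Lemma measurable_to_dmeasure d' (T : measurableType d') (f : T -> dmeasure) :
  (forall B, measurable B -> measurable_fun setT (fun t => f t B)) ->
  measurable_fun setT f.
Proof.
move=> mf; apply: (measurability dmeasure_gen) => //= _ [_ [B mB [Y mY <-] <-]].
by rewrite setTI; exact: mf.
Qed.

Import HBNNSimple.

Lemma measurable_dmeasure_integral (f : X -> \bar R) :
  measurable_fun setT f -> (forall x, 0 <= f x) ->
  measurable_fun [set: dmeasure] (fun eta : dmeasure => \int[eta]_x f x).
Proof.
move=> mf h0.
pose g := nnsfun_approx measurableT mf.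
pose intg := fun n (eta : dmeasure) => \int[eta]_x (g n x)%:E.
have mintg n : measurable_fun [set: dmeasure] (intg n).
  rewrite /intg.
  under eq_fun do rewrite integralT_nnsfun sintegralE.
  apply: emeasurable_fsum => //= r.
  by apply: measurable_funeM => //=; exact: measurable_dmeasure_eval.
apply: (emeasurable_fun_cvg _ (fun eta : dmeasure => \int[eta]_x f x) mintg).
move=> eta _.
rewrite (_ : \int[eta]_x f x = \int[eta]_x limn (fun n => (g n x)%:E)).
  apply: cvg_monotone_convergence => //.
  - by move=> n; exact/measurable_EFinP.
  - by move=> n x _; rewrite lee_fin.
  - by move=> t _ n m nm; rewrite lee_fin; exact/lefP/nd_nnsfun_approx.
apply: eq_integral => t _.
by apply/esym/cvg_lim  => //; exact/cvg_nnsfun_approx.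
Qed.

Definition total_mass (eta : dmeasure) : R := fine (eta setT).

Lemma total_mass_ge0 eta : (0 <= total_mass eta)%R.
Proof. exact: fine_ge0. Qed.

Lemma measurable_total_mass : measurable_fun setT total_mass.
Proof.
apply: measurableT_comp; first exact: fine_measurable.
exact: measurable_dmeasure_eval.
Qed.

Lemma total_mass_inv_ge0 eta : (0 <= (total_mass eta)^-1)%R.
Proof. by rewrite invr_ge0 total_mass_ge0. Qed.

Lemma finite_discrete_scale (r : {nonneg R}) (eta : dmeasure) :
  finite_discrete (mscale r eta).
Proof.
have [x [w [w0 woo etaE]]] := dmeasureP eta.
exists x, (fun i => r%:num * w i)%R; split.
- by move=> i; rewrite mulr_ge0.
- under eq_eseriesr do rewrite EFinM.
  rewrite nneseriesZl//; last by move=> i _; rewrite lee_fin.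
  rewrite lte_mul_pinfty//.
- move=> A; rewrite /mscale etaE -nneseriesZl//; last first.
    by move=> i _; rewrite mule_ge0// lee_fin.
  by apply: eq_eseriesr => i _; rewrite EFinM muleA.
Qed.

(* The zero measure is sent to itself. *)
Definition normalize (eta : dmeasure) : dmeasure :=
  DMeasure (finite_discrete_scale (NngNum (total_mass_inv_ge0 eta)) eta).

Lemma measurable_normalize : measurable_fun setT normalize.
Proof.
apply: measurable_to_dmeasure => B mB /=.
rewrite /mscale/=; apply: emeasurable_funM.
  apply/measurable_EFinP.
  under eq_fun do rewrite -powR_inv1 ?total_mass_ge0//.
  apply: (@measurableT_comp _ _ _ _ _ _ (fun x : R => x `^ (-1))%R) => //.
  exact: measurable_total_mass.
exact: measurable_dmeasure_eval.
Qed.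

HB.instance Definition _ :=
  isMeasurableFun.Build _ _ _ _ normalize measurable_normalize.

(* Takes the value 0 where the integral of a is infinite. *)
Definition linear_functional (a : X -> R) (eta : dmeasure) : R :=
  (\int[eta]_x a x)%R.

Lemma measurable_linear_functional (a : {mfun X >-> R}) :
  measurable_fun setT (linear_functional a).
Proof.
apply: measurableT_comp; first exact: fine_measurable.
under eq_fun do rewrite integralE.
have ma : measurable_fun setT (EFin \o a) by exact/measurable_EFinP.
apply: emeasurable_funB; apply: measurable_dmeasure_integral => //.
  exact: measurable_funepos.
exact: measurable_funeneg.
Qed.

HB.instance Definition _ (a : {mfun X >-> R}) := isMeasurableFun.Build _ _ _ _
  (linear_functional a) (measurable_linear_functional a).

End discrete_measures.
Arguments dmeasure {d} X R.

Definition Gamma (R : realType) (x : R) : R :=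
  (\int[@lebesgue_measure R]_(t in `]0%R, +oo[) (t `^ (x - 1) * expR (- t)))%R.

Section stable.
Context d (X : measurableType d) (R : realType).
Implicit Types (c alpha theta : R).

(* The law of the alpha-stable process on (X, nu) is specified by its Laplace
   transform: c * t ^ alpha is the integral of 1 - exp(- t * s) against the Levy
   measure c * alpha / Gamma(1 - alpha) * s ^ (- alpha - 1) ds.
   The integral of a with respect to eta may be infinite, in which case the
   exponential vanishes. *)
Definition stable_law c alpha (nu : probability X R)
    (P : probability (dmeasure X R) R) : Prop :=
  forall a : X -> R, measurable_fun setT a -> (forall x, (0 <= a x)%R) ->
    \int[nu]_x (a x `^ alpha)%:E < +oo ->
    \int[P]_eta expeR (- \int[eta]_x (a x)%:E) =
    expeR (- (c%:E * \int[nu]_x (a x `^ alpha)%:E)).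

Definition norm_const c alpha theta : R :=
  (c `^ (theta / alpha) * Gamma (theta + 1) / Gamma (theta / alpha + 1))%R.

Variable P : {measure set (dmeasure X R) -> \bar R}.

(* With the total functions of the library, this is 0 when theta <> 0 and eta
   is the zero measure. *)
Definition tilted_density c alpha theta (eta : dmeasure X R) : R :=
  (norm_const c alpha theta / (total_mass eta `^ theta))%R.

Definition tilted c alpha theta (A : set (dmeasure X R)) : \bar R :=
  \int[P]_(eta in A) (tilted_density c alpha theta eta)%:E.

Lemma tilted_density_ge0 c alpha theta eta :
  (0 <= tilted_density c alpha theta eta)%R.
Proof.
by rewrite !(mulr_ge0, invr_ge0, powR_ge0)// /Gamma fine_ge0//
  integral_ge0// => t _; rewrite lee_fin mulr_ge0 ?powR_ge0 ?expR_ge0.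
Qed.

Lemma measurable_tilted_density c alpha theta :
  measurable_fun setT (tilted_density c alpha theta).
Proof.
apply: measurable_funM => //.
under eq_fun do rewrite -powRN.
apply: (@measurableT_comp _ _ _ _ _ _ (fun x : R => x `^ (- theta))%R) => //.
exact: measurable_total_mass.
Qed.

Section tilted_measure.
Variables c alpha theta : R.

Let tilted0 : tilted c alpha theta set0 = 0.
Proof. exact: integral_set0. Qed.

Let tilted_ge0 A : 0 <= tilted c alpha theta A.
Proof. by apply: integral_ge0 => eta _; rewrite lee_fin tilted_density_ge0. Qed.

Let tilted_sigma_additive : semi_sigma_additive (tilted c alpha theta).
Proof.
move=> F mF tF mUF; rewrite /tilted ge0_integral_bigcup//.
- apply: is_cvg_ereal_nneg_natsum_cond => n _ _.
  by apply: integral_ge0 => eta _; rewrite lee_fin tilted_density_ge0.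
- apply/measurable_EFinP; apply: measurable_funTS.
  exact: measurable_tilted_density.
- by move=> eta _; rewrite lee_fin tilted_density_ge0.
Qed.

HB.instance Definition _ := isMeasure.Build _ _ _ (tilted c alpha theta)
  tilted0 tilted_ge0 tilted_sigma_additive.

End tilted_measure.

Definition normalized_tilted c alpha theta : set (dmeasure X R) -> \bar R :=
  pushforward (tilted c alpha theta) (@normalize _ X R).

End stable.

(* Main.v *)
Require Import Defs.
From HB Require Import structures.
From mathcomp Require Import all_boot all_order all_algebra.
From mathcomp Require Import all_classical all_reals all_analysis.
From mathcomp Require Import measurable_realfun.
From mathcomp Require Import ring lra.

(** Write S for the total mass of eta and W for S + z * A, where A is the
    integral of a with respect to eta. Applied to the functions t (1 + z a), the
    Laplace functional of the stable law says that

      E exp (- t W) = exp (- K t ^ alpha)   with K = c I,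

    where I is the integral of (1 + z a) ^ alpha with respect to nu; for z = 0
    this describes S, with K = c ([mass_plus_stable_laplace],
    [total_mass_stable_laplace]).

    Let Y be a standard exponential variable independent of eta. As Y exceeds
    t w with probability exp (- t w), the formula gives the tails of Y / W: they
    are those of (Y / K) ^ (1 / alpha). Hence these two variables have the same
    law ([integral_exp_div_stable]), and everything reduces to exponential
    variables:

    - the moments of order theta give
      Gamma (theta + 1) E W ^ (- theta) =
      Gamma (theta / alpha + 1) K ^ (- theta / alpha)
      for every theta > - alpha ([stable_negative_moment]);
    - the expected logarithms, for W and for S, give E ln (W / S) = ln I / alpha
      ([stable_log_ratio]).

    Finally, 1 + z u becomes W / S when u is the integral of a with respect to
    eta / S. For theta <> 0 the factor S ^ (- theta) of the density turns
    (W / S) ^ (- theta) into W ^ (- theta), whose expectation, multiplied by the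
    normalizing constant, is I ^ (- theta / alpha). For theta = 0 the density is
    1, and the expectation of alpha ln (W / S) is ln I. *)

Set Implicit Arguments.
Unset Strict Implicit.
Unset Printing Implicit Defensive.

Import Order.TTheory GRing.Theory Num.Theory.
Import numFieldNormedType.Exports.

Local Open Scope classical_set_scope.
Local Open Scope ring_scope.

(** * Measurability, densities and laws of real functions *)

(** Division by zero is covered by writing 1 / y as y * (y ^ 2) ^ (- 1). *)
Lemma measurable_funV d (T : measurableType d) (R : realType) (f : T -> R) :
  measurable_fun setT f -> measurable_fun setT (fun x => (f x)^-1).
Proof.
move=> mf.
have -> : (fun x => (f x)^-1) = (fun x => f x * (f x ^+ 2) `^ (- 1)).
  apply/funext => x; rewrite powR_inv1 ?sqr_ge0// expr2.
  have [->|f0] := eqVneq (f x) 0; first by rewrite invr0 mul0r.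
  by rewrite invfM mulrA divff// mul1r.
apply: measurable_funM => //.
apply: (@measurableT_comp _ _ _ _ _ _ (fun x : R => x `^ (- 1))).
  exact: measurable_powR.
exact: measurable_funX.
Qed.

Local Open Scope ereal_scope.

Lemma measurable_lt_fun d (T : measurableType d) (R : realType) (f g : T -> R) :
  measurable_fun setT f -> measurable_fun setT g ->
  measurable [set x | (f x < g x)%R].
Proof.
move=> mf mg; have := (measurable_fun_ltr mf mg) measurableT [set true] I.
by rewrite setTI.
Qed.

Lemma measurable_expeR (R : realType) :
  measurable_fun [set: \bar R] (@expeR R).
Proof.
rewrite (_ : @expeR R = fun x => maxe (er_map expR x) 0).
  apply: measurable_maxe => //.
  exact: (@measurable_er_map _ (measurableTypeR R) R _ (@measurable_expR R)).
apply/funext => -[r| |] /=.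
- by apply/esym/max_idPl; rewrite lee_fin expR_ge0.
- by apply/esym/max_idPl; rewrite leey.
- by apply/esym/max_idPr; rewrite leNye.
Qed.

Lemma measurable_laplace d (T : measurableType d) (R : realType) (W : T -> R)
    (t : R) :
  measurable_fun setT W -> measurable_fun setT (fun x => (expR (- (t * W x)))%:E).
Proof.
move=> mW; apply/measurable_EFinP; apply: (measurableT_comp (@measurable_expR R)).
apply: (measurableT_comp (@oppr_measurable R setT)).
exact: measurable_funM.
Qed.

Section density.
Import HBNNSimple.

(** Integration against a measure with density, obtained from indicators by
    the usual passage through simple functions and monotone convergence. *)
Lemma ge0_integral_density d (T : measurableType d) (R : realType)
    (mu m : {measure set T -> \bar R}) (rho : T -> R) (g : T -> \bar R) :
  measurable_fun setT rho -> (forall x, (0 <= rho x)%R) ->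
  (forall A, measurable A -> m A = \int[mu]_(x in A) (rho x)%:E) ->
  measurable_fun setT g -> (forall x, 0 <= g x) ->
  \int[m]_x g x = \int[mu]_x (g x * (rho x)%:E).
Proof.
move=> mrho rho0 mE mg g0.
pose h := nnsfun_approx measurableT mg.
have gE x : (h n x)%:E @[n --> \oo] --> g x by exact: cvg_nnsfun_approx.
have nd_h x : {homo (fun n => h n x) : a b / (a <= b)%N >-> (a <= b)%R}.
  by move=> a b ab; exact/lefP/nd_nnsfun_approx.
have mrho' : measurable_fun setT (EFin \o rho) by exact/measurable_EFinP.
transitivity (limn (fun n => \int[m]_x (h n x)%:E)).
  under eq_integral do rewrite -(cvg_lim _ (gE _))//.
  apply: monotone_convergence => //.
  - by move=> n; exact/measurable_EFinP.
  - by move=> n x _; rewrite lee_fin.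
  - by move=> x _ a b ab; rewrite lee_fin nd_h.
transitivity (limn (fun n => \int[mu]_x ((h n x)%:E * (rho x)%:E))); last first.
  have ghE x : (h n x)%:E * (rho x)%:E @[n --> \oo] --> g x * (rho x)%:E.
    exact: cvgeZr.
  under [RHS]eq_integral do rewrite -(cvg_lim _ (ghE _))//.
  apply/esym/monotone_convergence => //.
  - by move=> n; apply: emeasurable_funM => //; exact/measurable_EFinP.
  - by move=> n x _; rewrite mule_ge0 ?lee_fin.
  - by move=> x _ a b ab; rewrite lee_wpmul2r ?lee_fin ?nd_h.
congr (limn _); apply/funext => n.
rewrite integralT_nnsfun sintegralE.
transitivity (\int[mu]_x (\sum_(y \in range (h n))
    (y * \1_(h n @^-1` [set y]) x)%:E * (rho x)%:E)); last first.
  apply: eq_integral => x _.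
  rewrite -ge0_mule_fsuml => [|y]; last exact: nnfun_muleindic_ge0.
  by rewrite fsumEFin// -fimfunE.
rewrite ge0_integral_fsum//; last 2 first.
- move=> y; apply: emeasurable_funM => //.
  by apply/measurable_EFinP; exact: measurable_funM.
- by move=> y x _; apply: mule_ge0; [exact: nnfun_muleindic_ge0|rewrite lee_fin].
apply: eq_fsbigr => y /set_mem[x _ <-].
under eq_integral do rewrite EFinM -muleA.
rewrite ge0_integralZl//; last 3 first.
- by apply: emeasurable_funM => //; exact/measurable_EFinP.
- by move=> z _; rewrite mule_ge0 ?lee_fin.
- by rewrite lee_fin.
congr (_ * _); rewrite mE//.
under [RHS]eq_integral do rewrite muleC.
by rewrite [LHS]integral_mkcond; apply: eq_integral => z _; rewrite epatch_indic.
Qed.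

End density.

(** An integral is the difference of the integrals of the positive and negative
    parts even when these are infinite, and each part obeys the rule for
    nonnegative functions. *)
Lemma integral_pushforward_total d1 d2 (X : measurableType d1)
    (Y : measurableType d2) (R : realType) (mu : {measure set X -> \bar R})
    (phi : X -> Y) (g : Y -> \bar R) :
  measurable_fun setT phi -> measurable_fun setT g ->
  \int[pushforward mu phi]_y g y = \int[mu]_x g (phi x).
Proof.
move=> mphi mg; rewrite -[RHS]/(\int[mu]_x (g \o phi) x).
rewrite [LHS]integralE [RHS]integralE (funepos_comp g phi) (funeneg_comp g phi).
congr (_ - _); rewrite ge0_integral_pushforward//.
  exact: measurable_funepos.
exact: measurable_funeneg.
Qed.

(** The rays ]t, +oo[ are stable under intersection and generate the Borel
    sets of the line, so the tails determine the law of a real function. *)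
Lemma integral_eq_tails d1 d2 (T1 : measurableType d1)
    (T2 : measurableType d2) (R : realType) (P1 : {measure set T1 -> \bar R})
    (P2 : {measure set T2 -> \bar R}) (V : T1 -> R) (U : T2 -> R)
    (g : R -> \bar R) :
  P1 setT < +oo -> measurable_fun setT V -> measurable_fun setT U ->
  (forall t, P1 [set x | (t < V x)%R] = P2 [set x | (t < U x)%R]) ->
  measurable_fun setT g ->
  \int[P1]_x g (V x) = \int[P2]_x g (U x).
Proof.
move=> P1oo mV mU VU mg.
pose mV' : {mfun T1 >-> R} := HB.pack V (isMeasurableFun.Build _ _ _ _ _ mV).
pose mU' : {mfun T2 >-> R} := HB.pack U (isMeasurableFun.Build _ _ _ _ _ mU).
rewrite -(integral_pushforward_total P1 mV mg) -(integral_pushforward_total P2 mU mg).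
apply: eq_measure_integral => A mA _.
apply: (measure_unique (@RGenOInfty.G R) (fun n => `](- n%:R)%R, +oo[%classic)
  _ _ _ _ (pushforward P1 mV') (pushforward P2 mU')) => //.
- exact: RGenOInfty.measurableE.
- move=> _ _ [x ->] [y ->]; exists (Num.max x y).
  by apply/seteqP; split => z /=; rewrite !in_itv/= !andbT gt_max => /andP.
- by move=> n; exists (- n%:R)%R.
- rewrite -subTset => x _; exists (Num.truncn `|x|).+1 => //=.
  rewrite in_itv/= andbT ltrNl.
  by rewrite (le_lt_trans _ (truncnS_gt _))// -normrN ler_norm.
- have rayE T (f : T -> R) x : f @^-1` `]x, +oo[ = [set y | (x < f y)%R].
    by apply/seteqP; split => y /=; rewrite in_itv/= andbT.
  by move=> _ [x ->]; have := VU x; rewrite -!rayE.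
- move=> n; apply: le_lt_trans P1oo.
  apply: (@le_measure _ _ _ P1 (V @^-1` `](- n%:R)%R, +oo[)); rewrite ?inE//.
  by rewrite -[X in measurable X]setTI; exact: (mV measurableT _ (measurable_itv _)).
Qed.

Lemma fineZ (R : realType) (r : R) (x : \bar R) :
  fine (r%:E * x) = (r * fine x)%R.
Proof.
case: x => [s| |] //=; rewrite mulr0.
  by have [r0|r0|->] := ltgtP r 0%R;
    [rewrite lt0_muley ?lte_fin|rewrite gt0_muley ?lte_fin|rewrite mul0e].
by have [r0|r0|->] := ltgtP r 0%R;
    [rewrite lt0_muleNy ?lte_fin|rewrite gt0_muleNy ?lte_fin|rewrite mul0e].
Qed.

(** * Convergence of Euler's integral *)

(** The primitive x ^ (p + 1) / (p + 1) vanishes at 0, but its derivative may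
    blow up there: the integral is computed on the segments [1 / (n + 2), 1],
    where it is at most 1 / (p + 1), and these exhaust ]0, 1]. *)
Lemma integral_powR_01_lty (R : realType) (p : R) : (- 1 < p)%R ->
  \int[lebesgue_measure]_(x in `]0%R, 1%R]) (x `^ p)%:E < +oo.
Proof.
move=> p1.
have p10 : (0 < p + 1)%R by rewrite -ltrBlDr sub0r.
pose F (n : nat) : set R := [set x | x \in `[n.+2%:R^-1, 1]%R].
have mp D : measurable_fun (D : set (measurableTypeR R))
    (fun x : R => (x `^ p)%:E).
  by apply/measurable_EFinP/measurable_funTS; exact: measurable_powR.
have FE : `]0%R, 1%R]%classic = \bigcup_n F n.
  apply/seteqP; split => x /=; rewrite !in_itv/=.
    move=> /andP[x0 x1]; exists (Num.truncn x^-1) => //; rewrite /F/= in_itv/= x1 andbT.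
    rewrite -[leRHS]invrK lef_pV2 ?posrE ?invr_gt0//.
    apply/ltW/(lt_trans (truncnS_gt _)).
    by rewrite ltr_nat.
  by move=> [n _]; rewrite /F/= in_itv/= => /andP[/(lt_le_trans _)->].
rewrite FE.
have -> : \int[lebesgue_measure]_(x in \bigcup_n F n) (x `^ p)%:E =
    limn (fun n => \int[lebesgue_measure]_(x in F n) (x `^ p)%:E).
  apply/esym/cvg_lim => //; apply: ge0_nondecreasing_set_cvg_integral => //.
  - move=> m n mn; apply/subsetPset => x; rewrite /F/= !in_itv/= => /andP[mx ->].
    by rewrite (le_trans _ mx)// lef_pV2 ?posrE// ler_nat !ltnS.
  - by move=> n; exact: measurable_itv.
  - by move=> n x _; rewrite lee_fin powR_ge0.
apply: (@le_lt_trans _ _ ((p + 1)^-1)%:E); last exact: ltry.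
apply: lime_le.
  apply: ereal_nondecreasing_is_cvgn => m n mn.
  apply: ge0_subset_integral => //; [exact: measurable_itv|exact: measurable_itv| |].
    by move=> x _; rewrite lee_fin powR_ge0.
  move=> x; rewrite /F/= !in_itv/= => /andP[mx ->].
  by rewrite (le_trans _ mx)// lef_pV2 ?posrE// ler_nat !ltnS.
apply: nearW => n; set a : R := (n.+2%:R^-1)%R.
have a0 : (0 < a)%R by rewrite invr_gt0.
have a1 : (a < 1)%R by rewrite invf_lt1// ltr1n.
have pos x : (a <= x)%R -> x \in `]0%R, +oo[.
  by move=> ax; rewrite in_itv/= andbT (lt_le_trans a0).
have dpow q x : (a <= x)%R -> derivable (fun y : R => y `^ q)%R x 1.
  by move=> /pos/derivable_powR; exact.
have cpow q x : (a <= x)%R -> {for x, continuous (fun y : R => y `^ q)%R}.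
  by move=> ax; apply/differentiable_continuous/derivable1_diffP/dpow.
rewrite (@continuous_FTC2 _ _ (fun x => (p + 1)^-1 * x `^ (p + 1))%R)//.
- rewrite powR1 mulr1 -EFinB lee_fin lerBlDr lerDl.
  by rewrite mulr_ge0 ?powR_ge0// invr_ge0 ltW.
- apply: continuous_in_subspaceT => x /set_mem/=; rewrite in_itv/= => /andP[ax _].
  exact: cpow.
- split.
  + move=> x; rewrite in_itv/= => /andP[/ltW ax _].
by apply: derivableM => //; exact: dpow.
  + by apply/cvg_at_right_filter; apply: cvgM; [exact: cvg_cst|exact: cpow].
  + by apply/cvg_at_left_filter; apply: cvgM; [exact: cvg_cst|apply: cpow; exact: ltW].
- move=> x; rewrite in_itv/= => /andP[/ltW ax _].
  rewrite derive1Ml; last exact: dpow.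
  by rewrite powR_derive1 ?pos// mulrA mulVf ?gt_eqF// mul1r addrK.
Qed.

Lemma powR_le_expR_half (R : realType) (p : R) :
  exists2 C : R, (0 <= C)%R & forall t : R, (1 <= t)%R ->
    (t `^ p <= C * expR (2^-1 * t))%R.
Proof.
(* as t >= 1, the exponent may be raised, here to one that can be divided by *)
pose q : R := (`|p| + 1)%R.
have q0 : (0 < q)%R by rewrite ltr_pwDr.
exists (expR (q * ln (2 * q)))%R; first exact: expR_ge0.
move=> t t1; have t0 : (0 < t)%R by rewrite (lt_le_trans _ t1).
apply: (@le_trans _ _ (t `^ q)%R).
  by rewrite ler_powR// /q (le_trans (ler_norm p))// lerDl.
rewrite -expRD /powR gt_eqF// ler_expR -lerBlDl -mulrBr.
rewrite -ln_div ?posrE ?mulr_gt0//.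
(* ln x <= x at x = t / (2 q), for which q x = t / 2 *)
apply: (@le_trans _ _ (q * (t / (2 * q)))%R).
  by rewrite ler_pM2l// ltW// ln_sublinear// divr_gt0// mulr_gt0.
by rewrite le_eqVlt; apply/orP; left; apply/eqP; field; rewrite gt_eqF.
Qed.

Lemma measurable_Gamma_integrand (R : realType) (p : R)
    (D : set (measurableTypeR R)) :
  measurable_fun D (fun t : R => (t `^ p * expR (- t))%:E).
Proof.
apply/measurable_EFinP/measurable_funTS; apply: measurable_funM.
  exact: measurable_powR.
have mN : measurable_fun [set: measurableTypeR R] (fun t : R => - t : R)%R.
  exact: oppr_measurable.
exact: (measurableT_comp (@measurable_expR R) mN).
Qed.

(** Near 0 the integrand is at most t ^ p; beyond 1 it is at most a multiple of
    exp (- t / 2), that is, of the exponential density of rate 1 / 2. *)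
Lemma Gamma_integral_lty (R : realType) (p : R) : (- 1 < p)%R ->
  \int[lebesgue_measure]_(t in `]0%R, +oo[) (t `^ p * expR (- t))%:E < +oo.
Proof.
move=> p1; have [C C0 HC] := powR_le_expR_half p.
have mf := measurable_Gamma_integrand p.
rewrite (@itv_bndbnd_setU _ _ _ (BRight 1%R))//; first last.
  by rewrite bnd_simp.
rewrite ge0_integral_setU//; last 2 first.
- by move=> t _; rewrite lee_fin mulr_ge0 ?powR_ge0 ?expR_ge0.
- apply/disj_setPS => t []/=; rewrite !in_itv/= => /andP[_ t1].
  by rewrite ltNge t1.
apply: lte_add_pinfty.
  apply: le_lt_trans (integral_powR_01_lty p1).
  apply: ge0_le_integral => //.
  - by move=> t _; rewrite lee_fin mulr_ge0 ?powR_ge0 ?expR_ge0.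
  - apply/measurable_EFinP/measurable_funTS; exact: measurable_powR.
  - move=> t /=; rewrite in_itv/= => /andP[/ltW t0 _].
    by rewrite lee_fin ler_piMr ?powR_ge0// expR_le1 oppr_le0.
have mg : measurable_fun setT (fun t : R => ((2 * C)%:E * (exponential_pdf 2^-1 t)%:E)).
  apply: emeasurable_funM => //; apply/measurable_EFinP.
  exact: measurable_exponential_pdf.
apply: (@le_lt_trans _ _ (\int[lebesgue_measure]_(t in `]1%R, +oo[)
    ((2 * C)%:E * (exponential_pdf 2^-1 t)%:E))).
  apply: ge0_le_integral => //.
  - by move=> t _; rewrite lee_fin mulr_ge0 ?powR_ge0 ?expR_ge0.
  - exact: measurable_funTS.
  - move=> t /=; rewrite in_itv/= andbT => t1.
    have t0 : (0 <= t)%R by rewrite ltW// (lt_trans _ t1).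
    rewrite -EFinM lee_fin exponential_pdfE// mulrACA divff// mul1r.
    apply: (@le_trans _ _ (C * expR (2^-1 * t) * expR (- t))%R).
      by rewrite ler_wpM2r ?expR_ge0// HC// ltW.
    rewrite -mulrA -expRD ler_wpM2l// ler_expR.
    by rewrite le_eqVlt; apply/orP; left; apply/eqP; field.
apply: (@le_lt_trans _ _ (\int[lebesgue_measure]_t
    ((2 * C)%:E * (exponential_pdf 2^-1 t)%:E))).
  apply: ge0_subset_integral => //.
  move=> t _; apply: mule_ge0; rewrite lee_fin ?mulr_ge0//.
  by rewrite exponential_pdf_ge0.
rewrite ge0_integralZl//.
- by rewrite integral_exponential_pdf ?invr_gt0// mule1 ltry.
- by apply/measurable_EFinP; exact: measurable_exponential_pdf.
- by move=> t _; rewrite lee_fin exponential_pdf_ge0.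
- by rewrite lee_fin mulr_ge0.
Qed.

(** * The standard exponential law *)

(** The exponential law of rate 1, as a probability: the canonical structure on
    [exponential_prob] needs the positivity of the rate as an argument. *)
Definition std_exp (R : realType) : probability (measurableTypeR R) R :=
  exponential_distribution_exponential_prob__canonical__probability_measure_Probability
    (@ltr01 R).

Lemma measurable_normR (R : realType) :
  measurable_fun [set: measurableTypeR R] (fun y : R => `|y|%R).
Proof. exact: normr_measurable. Qed.

Lemma measurable_normR_powR (R : realType) (p : R) :
  measurable_fun [set: measurableTypeR R] (fun y : R => (`|y| `^ p)%:E).
Proof.
apply/measurable_EFinP.
exact: (measurableT_comp (@measurable_powR R p) (@measurable_normR R)).
Qed.

(** The tail of the exponential law. The absolute value makes the variable
    nonnegative everywhere and not only almost everywhere, which avoids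
    exceptional sets when quotients and real powers of it are formed. *)
Lemma std_exp_norm_gt (R : realType) (x : R) : (0 <= x)%R ->
  std_exp R [set y : R | (x < `|y|)%R] = (expR (- x))%:E.
Proof.
move=> x0.
pose A : set (measurableTypeR R) := `[0%R, x]%classic.
have mA : measurable A by exact: measurable_itv.
have AE : [set y : R | (x < `|y|)%R] = ~` [set y : R | (`|y| <= x)%R].
  by apply/seteqP; split => y /=; rewrite ltNge => /negP.
have mN : measurable ([set y : R | (`|y| <= x)%R] : set (measurableTypeR R)).
  have -> : [set y : R | (`|y| <= x)%R] =
      [set: R] `&` (fun y : R => `|y|%R) @^-1` [set` `]-oo, x]%R].
    by rewrite setTI; apply/seteqP; split => y /=; rewrite in_itv.
  exact: (@measurable_normR R measurableT _ (measurable_itv _)).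
rewrite AE probability_setC//.
suff -> : std_exp R [set y : R | (`|y| <= x)%R] = 1 - (expR (- x))%:E.
  by rewrite -!EFinB subKr.
transitivity (exponential_prob (1 : R) A).
  rewrite /std_exp/= /exponential_prob [LHS]integral_mkcond [RHS]integral_mkcond.
  apply: eq_integral => y _; rewrite !patchE.
  have [y0|y0] := ltP y 0%R.
    by rewrite lt0_exponential_pdf//; case: ifP => _; case: ifP.
  congr (if _ then _ else _).
  apply/idP/idP => /set_mem yx; apply/mem_set; move: yx;
    by rewrite /A/= in_itv/= y0 ger0_norm.
have [xE|xN0] := eqVneq x 0%R; last first.
  by rewrite exponential_prob_itv0c ?mulN1r// lt_neqAle eq_sym xN0.
by rewrite /A xE set_itv1 /exponential_prob integral_set1 oppr0 expR0 subee.
Qed.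

Lemma ae_std_exp_norm_gt0 (R : realType) :
  {ae std_exp R, forall y : R, (0 < `|y|)%R}.
Proof.
have mA : measurable ([set y : R | (0 < `|y|)%R] : set (measurableTypeR R)).
  by apply: (measurable_lt_fun (f := cst 0%R)) => //; exact: measurable_normR.
exists (~` [set y : R | (0 < `|y|)%R]); split => //; first exact: measurableC.
by rewrite probability_setC// std_exp_norm_gt// oppr0 expR0 subee.
Qed.

Lemma integral_std_exp_powR (R : realType) (p : R) :
  \int[std_exp R]_y (`|y| `^ p)%:E =
  \int[lebesgue_measure]_(t in `]0%R, +oo[) (t `^ p * expR (- t))%:E.
Proof.
have mpdf : measurable_fun [set: measurableTypeR R] (exponential_pdf (1 : R)).
  exact: measurable_exponential_pdf.
rewrite (@ge0_integral_density _ _ _ lebesgue_measure _ (exponential_pdf 1))//; last 2 first.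
- by move=> y; rewrite exponential_pdf_ge0.
- exact: measurable_normR_powR.
rewrite integral_itv_obnd_cbnd; last exact: measurable_Gamma_integrand.
rewrite [RHS]integral_mkcond; apply: eq_integral => t _.
rewrite patchE; case: ifPn => [|tN].
  rewrite inE/= in_itv/= andbT => t0.
  by rewrite exponential_pdfE// mul1r mulN1r ger0_norm// EFinM.
rewrite lt0_exponential_pdf ?mule0//.
by move: tN; rewrite notin_setE/= in_itv/= andbT => /negP; rewrite -ltNge.
Qed.

(** The Gamma function is the moment function of the exponential law; with the
    finiteness of Euler's integral the equality holds in the extended reals. *)
Lemma integral_std_exp_Gamma (R : realType) (p : R) : (- 1 < p)%R ->
  \int[std_exp R]_y (`|y| `^ p)%:E = (Gamma (p + 1))%:E.
Proof.
move=> p1; rewrite integral_std_exp_powR /Gamma /Rintegral addrK fineK//.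
rewrite ge0_fin_numE; first exact: Gamma_integral_lty.
by apply: integral_ge0 => t _; rewrite lee_fin mulr_ge0 ?powR_ge0 ?expR_ge0.
Qed.

(** If the moment vanished, the exponential variable would be almost surely
    0, but it is almost surely nonzero. *)
Lemma Gamma_gt0 (R : realType) (p : R) : (- 1 < p)%R -> (0 < Gamma (p + 1))%R.
Proof.
move=> p1; rewrite -lte_fin -integral_std_exp_Gamma//.
rewrite lt0e; apply/andP; split; last first.
  by apply: integral_ge0 => y _; rewrite lee_fin powR_ge0.
apply/eqP => I0.
have := ae_eq_integral_abs (std_exp R) measurableT (measurable_normR_powR p).
under eq_integral do rewrite gee0_abs ?lee_fin ?powR_ge0//.
move=> [/(_ I0) + _] => y0.
have : std_exp R [set y : R | (0 < `|y|)%R] = 0.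
  apply: measure_negligible.
    have -> : [set y : R | (0 < `|y|)%R] =
        [set: R] `&` (fun y : R => `|y|%R) @^-1` [set` `]0%R, +oo[].
      by rewrite setTI; apply/seteqP; split => y /=; rewrite in_itv/= andbT.
    exact: (@measurable_normR R measurableT _ (measurable_itv _)).
  apply: negligibleS y0 => y /= y0 /(_ I)/eqP.
  by rewrite eqe gt_eqF// powR_gt0.
by rewrite std_exp_norm_gt// oppr0 expR0 => /eqP; rewrite eqe oner_eq0.
Qed.

(** ln y < y bounds the positive part; the same inequality at y ^ (- 1 / 2)
    bounds the negative part by a function that the exponential law
    integrates. *)
Lemma normr_ln_le (R : realType) (y : R) : (0 < y)%R ->
  (`|ln y| <= y + 2 * y `^ (- 2^-1))%R.
Proof.
move=> y0; rewrite ler_norml; apply/andP; split.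
  rewrite lerNl; have := ln_sublinear (powR_gt0 (- 2^-1) y0).
  rewrite ln_powR => /ltW; rewrite -(ler_pM2l (ltr0n R 2)).
  rewrite mulrA mulrN mulfV// mulN1r => /le_trans; apply.
  by rewrite lerDr ltW.
apply: (le_trans (ltW (ln_sublinear y0))).
by rewrite lerDl mulr_ge0 ?powR_ge0.
Qed.

Lemma integrable_ln_std_exp (R : realType) :
  (std_exp R).-integrable setT (fun y : R => (ln `|y|)%:E).
Proof.
have mln : measurable_fun [set: measurableTypeR R] (fun y : R => ln `|y|).
  exact: (measurableT_comp (@measurable_ln R) (@measurable_normR R)).
have mp := @measurable_normR_powR R.
apply/integrableP; split; first exact/measurable_EFinP.
apply: (@le_lt_trans _ _ (\int[std_exp R]_y
    ((`|y| `^ 1)%:E + 2%:E * (`|y| `^ (- 2^-1))%:E))).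
  apply: ge0_le_integral => //.
  - by do 2 apply: measurableT_comp => //.
  - by apply: emeasurable_funD => //; exact: measurable_funeM.
  - move=> y _; rewrite -EFinM -EFinD lee_fin powRr1//.
    have [->|y0] := eqVneq y 0%R.
      by rewrite normr0 ln0// normr0 add0r mulr_ge0 ?powR_ge0.
    by rewrite normr_ln_le ?normr_gt0.
have h2 : (- 1 < - 2^-1 :> R)%R by rewrite ltrN2 invf_lt1// ltr1n.
rewrite ge0_integralD//; last exact: measurable_funeM.
have h1 : (- 1 < 1 :> R)%R by rewrite (lt_trans _ ltr01)// oppr_lt0.
by rewrite ge0_integralZl// !integral_std_exp_Gamma// -EFinM -EFinD ltry.
Qed.

Lemma measurable_exp_powR (R : realType) (K r : R) :
  measurable_fun [set: measurableTypeR R] (fun y : R => (`|y| / K) `^ r)%R.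
Proof.
have mdiv : measurable_fun [set: measurableTypeR R] (fun y : R => `|y| / K)%R.
  by apply: measurable_funM => //; exact: measurable_normR.
exact: (measurableT_comp (@measurable_powR R r) mdiv).
Qed.

Lemma ln_exp_powR (R : realType) (K alpha y : R) : (0 < K)%R -> (0 < `|y|)%R ->
  ln ((`|y| / K) `^ alpha^-1) = (alpha^-1 * (ln `|y| - ln K))%R.
Proof. by move=> K0 y0; rewrite ln_powR ln_div. Qed.

Lemma integrable_ln_exp_powR (R : realType) (K alpha : R) : (0 < K)%R ->
  (0 < alpha)%R ->
  (std_exp R).-integrable setT (fun y : R => (ln ((`|y| / K) `^ alpha^-1))%:E).
Proof.
move=> K0 a0.
have iK : (std_exp R).-integrable setT
    (fun y : R => (alpha^-1)%:E * ((ln `|y|)%:E - (ln K)%:E)).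
  apply: integrableZl => //; apply: integrableB => //.
    exact: integrable_ln_std_exp.
  exact: finite_measure_integrable_cst.
apply: le_integrable iK => //.
  apply/measurable_EFinP.
  exact: (measurableT_comp (@measurable_ln R) (@measurable_exp_powR R K _)).
move=> y _.
have [->|y0] := eqVneq y 0%R.
  by rewrite normr0 mul0r powR0 ?invr_eq0 ?gt_eqF// ln0// abse0.
by rewrite ln_exp_powR ?normr_gt0.
Qed.

Lemma integral_ln_exp_powRB (R : realType) (K1 K2 alpha : R) : (0 < K1)%R ->
  (0 < K2)%R -> (0 < alpha)%R ->
  \int[std_exp R]_y (ln ((`|y| / K1) `^ alpha^-1))%:E -
  \int[std_exp R]_y (ln ((`|y| / K2) `^ alpha^-1))%:E =
  (alpha^-1 * ln (K2 / K1))%:E.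
Proof.
move=> K10 K20 a0.
have i1 := integrable_ln_exp_powR K10 a0.
have i2 := integrable_ln_exp_powR K20 a0.
rewrite -integralB//.
transitivity (\int[std_exp R]_y (cst (alpha^-1 * ln (K2 / K1))%:E y)); last first.
  rewrite integral_cst//; set m := (X in _ * X).
  by have -> : m = 1 by [exact: probability_setT]; rewrite mule1.
apply: ae_eq_integral => //.
- exact: emeasurable_funB (measurable_int _ i1) (measurable_int _ i2).
- have [N [mN PN sN]] := ae_std_exp_norm_gt0 R; exists N; split => // y yN.
  apply: sN => y0; apply: yN => _ /=.
  rewrite !ln_exp_powR// -EFinB ln_div ?posrE//; congr EFin; ring.
Qed.

(** * Exponential variables divided by stable variables *)

(** For 0 < alpha < 1 this is the Laplace transform of the positive stable law
    of index [alpha]. *)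
Definition stable_laplace d (T : measurableType d) (R : realType)
    (P : probability T R) (K alpha : R) (W : T -> R) :=
  forall t, (0 <= t)%R ->
    \int[P]_x (expR (- (t * W x)))%:E = (expR (- (K * t `^ alpha)))%:E.

(** On the event W = 0 the integrand exp (- t W) is 1, so this event has
    probability at most exp (- K t ^ alpha), which tends to 0 as t grows. *)
Lemma stable_laplace_ae_gt0 d (T : measurableType d) (R : realType)
    (P : probability T R) (K alpha : R) (W : T -> R) :
  (0 < K)%R -> (0 < alpha)%R -> measurable_fun setT W ->
  (forall x, 0 <= W x)%R -> stable_laplace P K alpha W ->
  {ae P, forall x, (0 < W x)%R}.
Proof.
move=> K0 a0 mW W0 LW.
have mN0 : measurable (~` [set x | (0 < W x)%R]).
  by apply: measurableC; exact: measurable_lt_fun.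
exists (~` [set x | (0 < W x)%R]); split => //.
apply/eqP; rewrite eq_le measure_ge0 andbT.
apply/lee_addgt0Pr => e e0; rewrite add0e.
(* chosen so that K t ^ alpha = 1 / e, and exp (- 1 / e) <= e *)
pose t : R := (((K * e)^-1) `^ alpha^-1)%R.
have Kt : (K * t `^ alpha = e^-1)%R.
  rewrite -powRrM mulVf ?gt_eqF// powRr1 ?invr_ge0 ?mulr_ge0 ?ltW//.
  by rewrite invfM mulrA mulfV ?gt_eqF// mul1r.
apply: (@le_trans _ _ (\int[P]_x (expR (- (t * W x)))%:E)).
  rewrite -(setIT (~` _)) -integral_indic//; apply: ge0_le_integral => //.
  - by apply/measurable_EFinP; exact: measurable_indic.
  - exact: measurable_laplace.
  - move=> x _; rewrite lee_fin indicE.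
    case: (boolP (x \in _)) => [|_]; last exact: expR_ge0.
    rewrite inE/= => /negP; rewrite -leNgt => Wx.
    have -> : W x = 0%R by apply/eqP; rewrite eq_le Wx W0.
    by rewrite mulr0 oppr0 expR0.
rewrite LW ?powR_ge0// Kt lee_fin expRN -[leRHS]invrK lef_pV2 ?posrE ?expR_gt0 ?invr_gt0//.
by rewrite (le_trans _ (expR_ge1Dx _))// lerDr.
Qed.

Lemma measurable_exp_div d (T : measurableType d) (R : realType) (W : T -> R) :
  measurable_fun setT W ->
  measurable_fun setT (fun z : T * measurableTypeR R => `|z.2 : R| / W z.1)%R.
Proof.
move=> mW; apply: measurable_funM.
  exact: (measurableT_comp (@measurable_normR R) measurable_snd).
apply: measurable_funV.
exact: (measurableT_comp mW measurable_fst).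
Qed.

Lemma product_std_exp_setT d (T : measurableType d) (R : realType)
    (P : probability T R) : (P \x std_exp R) setT = 1.
Proof.
rewrite -setXTT; transitivity (P setT * std_exp R setT).
  exact: product_measure1E.
by rewrite !probability_setT mule1.
Qed.

(** If Y is exponential and independent of [W], then conditionally on [W] the
    event Y / W > t has probability exp (- t W). Its probability is therefore
    the Laplace transform of [W] at t, which is also the probability that
    Y > K t ^ alpha. *)
Lemma exp_div_stable_tails d (T : measurableType d) (R : realType)
    (P : probability T R) (K alpha : R) (W : T -> R) (t : R) :
  (0 < K)%R -> (0 < alpha)%R -> measurable_fun setT W ->
  (forall x, 0 <= W x)%R -> stable_laplace P K alpha W ->
  (P \x std_exp R) [set z | (t < `|z.2| / W z.1)%R] =
  std_exp R [set y | (t < (`|y| / K) `^ alpha^-1)%R].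
Proof.
move=> K0 a0 mW W0 LW.
have mt : measurable [set z : T * measurableTypeR R | (t < `|z.2 : R| / W z.1)%R].
  by apply: measurable_lt_fun => //; exact: measurable_exp_div.
(* for t < 0 both events are certain *)
have [t0|t0] := ltP t 0%R.
  have -> : [set z : T * measurableTypeR R | (t < `|z.2 : R| / W z.1)%R] = setT.
    apply/seteqP; split => // z _ /=.
    by rewrite (lt_le_trans t0)// divr_ge0.
  rewrite product_std_exp_setT.
  have -> : [set y : measurableTypeR R | (t < (`|y : R| / K) `^ alpha^-1)%R] = setT.
    by apply/seteqP; split => // y _ /=; rewrite (lt_le_trans t0)// powR_ge0.
  by rewrite probability_setT.
have -> : [set y : measurableTypeR R | (t < (`|y : R| / K) `^ alpha^-1)%R] =
    [set y | (K * t `^ alpha < `|y : R|)%R].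
  apply/seteqP; split => y /=.
    move=> /(gt0_ltr_powR a0); rewrite !nnegrE t0 powR_ge0 => /(_ isT isT).
    rewrite -powRrM mulVf ?gt_eqF// powRr1; last by rewrite divr_ge0// ltW.
    by rewrite ltr_pdivlMr// mulrC.
  rewrite mulrC -ltr_pdivlMr// => /(@gt0_ltr_powR _ alpha^-1).
  rewrite invr_gt0 a0 !nnegrE powR_ge0 divr_ge0// ?ltW// => /(_ isT isT isT).
  by rewrite -powRrM mulfV ?gt_eqF// powRr1.
rewrite std_exp_norm_gt ?mulr_ge0 ?powR_ge0 ?ltW// -LW//.
apply: ge0_ae_eq_integral => //.
- exact: measurable_fun_xsection.
- exact: measurable_laplace.
- apply: filterS (stable_laplace_ae_gt0 K0 a0 mW W0 LW) => x Wx _ /=.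
  rewrite -std_exp_norm_gt ?mulr_ge0//; congr (std_exp R _).
  by rewrite /xsection; apply/seteqP; split => y /=; rewrite in_setE/= ltr_pdivlMr.
Qed.

(** The identity in law behind the theorem: Y / W and (Y / K) ^ (1 / alpha) have
    the same law. It replaces [W], known through its Laplace transform only, by
    an explicit function of an exponential variable. *)
Lemma integral_exp_div_stable d (T : measurableType d) (R : realType)
    (P : probability T R) (K alpha : R) (W : T -> R) (g : R -> \bar R) :
  (0 < K)%R -> (0 < alpha)%R -> measurable_fun setT W ->
  (forall x, 0 <= W x)%R -> stable_laplace P K alpha W ->
  measurable_fun setT g ->
  \int[P \x std_exp R]_z g (`|z.2| / W z.1)%R =
  \int[std_exp R]_y g ((`|y| / K) `^ alpha^-1)%R.
Proof.
move=> K0 a0 mW W0 LW mg; apply: integral_eq_tails => //.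
- by have := ltry (1 : R)%R; rewrite -(product_std_exp_setT P).
- exact: measurable_exp_div.
- exact: measurable_exp_powR.
- move=> t; exact: exp_div_stable_tails.
Qed.

(** Moments of order [theta] of the two sides of the identity in law: the left
    one splits as Gamma (theta + 1) times the moment of order - theta of [W]
    by independence, the right one is a moment of Y. The same computation
    covers both signs of [theta]. *)
Lemma stable_negative_moment d (T : measurableType d) (R : realType)
    (P : probability T R) (K alpha theta : R) (W : T -> R) :
  (0 < K)%R -> (0 < alpha)%R -> (- 1 < theta)%R -> (- 1 < theta / alpha)%R ->
  measurable_fun setT W ->
  (forall x, 0 <= W x)%R -> stable_laplace P K alpha W ->
  \int[P]_x (W x `^ (- theta))%:E =
  (Gamma (theta / alpha + 1) / Gamma (theta + 1) * K `^ (- (theta / alpha)))%:E.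
Proof.
move=> K0 a0 th1 tha1 mW W0 LW.
have mWth : measurable_fun setT (fun x => (W x `^ (- theta))%R).
  exact: (measurableT_comp (@measurable_powR R _) mW).
have mg : measurable_fun setT (fun x : R => (x `^ theta)%:E).
  by apply/measurable_EFinP; exact: measurable_powR.
have mn := @measurable_normR_powR R.
have invpow (x p : R) : (0 <= x)%R -> ((x^-1) `^ p = x `^ (- p))%R.
  by move=> x0; rewrite -powR_inv1// -powRrM mulN1r.
have := integral_exp_div_stable K0 a0 mW W0 LW mg.
rewrite fubini_tonelli1//=; last 2 first.
- by apply: (measurableT_comp mg); exact: measurable_exp_div.
- by move=> z; rewrite lee_fin powR_ge0.
rewrite /fubini_F/=.
have -> : \int[std_exp R]_y (((`|y| / K) `^ alpha^-1) `^ theta)%:E =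
    (K `^ (- (theta / alpha)) * Gamma (theta / alpha + 1))%:E.
  rewrite EFinM -integral_std_exp_Gamma// -ge0_integralZl ?lee_fin ?powR_ge0//.
  apply: eq_integral => y _.
  rewrite -powRrM (mulrC _ theta) powRM ?invr_ge0 ?(ltW K0)//.
  by rewrite invpow ?(ltW K0)// -EFinM (mulrC (K `^ _)%R).
under eq_integral => x _.
  under eq_integral => y _.
    rewrite powRM ?invr_ge0// invpow// mulrC EFinM.
    over.
  rewrite ge0_integralZl ?lee_fin ?powR_ge0// integral_std_exp_Gamma// muleC.
  over.
have G0 : (0 < Gamma (theta + 1))%R by exact: Gamma_gt0.
rewrite ge0_integralZl//; last 3 first.
- exact/measurable_EFinP.
- by move=> x _; rewrite lee_fin powR_ge0.
- by rewrite lee_fin ltW.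
move=> /(congr1 (mule (Gamma (theta + 1))^-1%:E)).
rewrite muleA -EFinM mulVf ?gt_eqF// mul1e => ->.
by rewrite -EFinM mulrCA mulrC (mulrC (Gamma (theta / alpha + 1))).
Qed.

(** Expected logarithms of the identity in law, for [W1] and for [W2]. The
    logarithm of Y is integrable, so the two expectations can be subtracted;
    Y then cancels on both sides. *)
Lemma stable_log_ratio d (T : measurableType d) (R : realType)
    (P : probability T R) (K1 K2 alpha : R) (W1 W2 : T -> R) :
  (0 < K1)%R -> (0 < K2)%R -> (0 < alpha)%R ->
  measurable_fun setT W1 -> measurable_fun setT W2 ->
  (forall x, 0 <= W1 x)%R -> (forall x, W1 x <= W2 x)%R ->
  stable_laplace P K1 alpha W1 -> stable_laplace P K2 alpha W2 ->
  \int[P]_x (ln (W2 x / W1 x))%:E = (alpha^-1 * ln (K2 / K1))%:E.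
Proof.
move=> K10 K20 a0 mW1 mW2 W10 W12 L1 L2.
have W20 x : (0 <= W2 x)%R by rewrite (le_trans (W10 x)).
have mlnE : measurable_fun setT (EFin \o @ln R).
  by apply/measurable_EFinP; exact: measurable_ln.
have iln (K : R) (W : T -> R) : (0 < K)%R -> measurable_fun setT W -> (forall x, 0 <= W x)%R ->
    stable_laplace P K alpha W ->
    (P \x std_exp R).-integrable setT (fun z => (ln (`|z.2| / W z.1))%:E).
  move=> K0 mW W0 LW; apply/integrableP; split.
    exact: (measurableT_comp mlnE (measurable_exp_div mW)).
  have /integrableP[_] := integrable_ln_exp_powR K0 a0.
  have mg : measurable_fun setT (fun x : R => `|(ln x)%:E|).
    exact: (measurableT_comp _ mlnE).
  by rewrite -(integral_exp_div_stable K0 a0 mW W0 LW mg).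
have i1 := iln _ _ K10 mW1 W10 L1.
have i2 := iln _ _ K20 mW2 W20 L2.
rewrite -(integral_ln_exp_powRB K10 K20 a0).
rewrite -(integral_exp_div_stable K10 a0 mW1 W10 L1 mlnE).
rewrite -(integral_exp_div_stable K20 a0 mW2 W20 L2 mlnE).
rewrite -integralB//.
have mr : measurable_fun setT (fun x => ln (W2 x / W1 x)).
  apply: (measurableT_comp (@measurable_ln R)); apply: measurable_funM => //.
  exact: measurable_funV.
have r0 x : (0 <= ln (W2 x / W1 x))%R.
  have [W1x|] := ltP 0%R (W1 x).
    by rewrite ln_ge0// ler_pdivlMr// mul1r.
  by move=> W1x; rewrite (_ : W1 x = 0%R) ?invr0 ?mulr0 ?ln0//; apply/eqP; rewrite eq_le W1x W10.
transitivity (\int[P \x std_exp R]_z (ln (W2 z.1 / W1 z.1))%:E).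
  rewrite fubini_tonelli1//=; last 2 first.
  - apply/measurable_EFinP.
    exact: (measurableT_comp mr measurable_fst).
  - by move=> z; rewrite lee_fin.
  rewrite /fubini_F/=; apply: eq_integral => x _.
  rewrite integral_cst//; set m := (X in _ * X).
  by have -> : m = 1 by [exact: probability_setT]; rewrite mule1.
apply: ae_eq_integral => //.
- by apply/measurable_EFinP; exact: (measurableT_comp mr measurable_fst).
- exact: emeasurable_funB (measurable_int _ i1) (measurable_int _ i2).
have [N [mN PN NW]] := stable_laplace_ae_gt0 K10 a0 mW1 W10 L1.
have [M [mM PM MY]] := ae_std_exp_norm_gt0 R.
exists ((N `*` setT) `|` (setT `*` M)); split.
- by apply: measurableU; exact: measurableX.
- apply: null_set_setU; [exact: measurableX|exact: measurableX| |].
    transitivity (P N * std_exp R setT); first exact: product_measure1E.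
    by rewrite PN mul0e.
  transitivity (P setT * std_exp R M); first exact: product_measure1E.
  by rewrite PM mule0.
- move=> z /= /not_implyP[_ zE]; apply: contrapT => /not_orP[zN zM]; apply: zE.
  have W1z : (0 < W1 z.1)%R.
    by apply: contrapT => h; apply: zN; split => //; exact: NW.
  have z20 : (0 < `|z.2|)%R.
    by apply: contrapT => h; apply: zM; split => //; exact: MY.
  have W2z : (0 < W2 z.1)%R by rewrite (lt_le_trans W1z).
  by rewrite !ln_div ?posrE// -EFinB; congr EFin; ring.
Qed.

(** * Linear functionals of the stable process *)

(** Both 1 and x are at most their maximum. *)
Lemma powR_1D_le (R : realType) (alpha x : R) : (0 <= alpha)%R -> (0 <= x)%R ->
  ((1 + x) `^ alpha <= 2 `^ alpha * (1 + x `^ alpha))%R.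
Proof.
move=> a0 x0; pose m := Num.max 1%R x.
have m0 : (0 <= m)%R by rewrite le_max ler01.
apply: (@le_trans _ _ ((2 * m) `^ alpha)%R).
  apply: ge0_ler_powR => //; rewrite ?nnegrE ?mulr_ge0 ?addr_ge0//.
  by rewrite mulrDl !mul1r lerD// le_max lexx ?orbT.
rewrite powRM// ler_wpM2l ?powR_ge0// /m; case: (leP 1%R x) => _.
  by rewrite lerDr.
by rewrite powR1 lerDl powR_ge0.
Qed.

Section stable_process.
Variables (R : realType) (d : measure_display) (X : measurableType d).
Variables (nu : probability X R) (c alpha : R) (P : probability (dmeasure X R) R).
Variable a : {mfun X >-> R}.
Hypotheses (c0 : (0 < c)%R) (alpha0 : (0 < alpha)%R).
Hypothesis stableP : stable_law c alpha nu P.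
Hypothesis a0 : forall x, (0 <= a x)%R.
Hypothesis a_alpha : \int[nu]_x (a x `^ alpha)%:E < +oo.

Let mass_lty (eta : dmeasure X R) : eta setT < +oo.
Proof.
have [x [w [w0 woo ->]]] := dmeasureP eta.
by under eq_eseriesr do rewrite diracT mule1.
Qed.

Let mintP : measurable_fun setT (fun eta : dmeasure X R => \int[eta]_x (a x)%:E).
Proof.
apply: measurable_dmeasure_integral; first exact/measurable_EFinP.
by move=> x; rewrite lee_fin.
Qed.

(** On the event where the integral is infinite, the integrand of the Laplace
    transform vanishes, so that the transform at s bounds from below the
    probability of the complement. As s tends to 0 the transform tends to 1. *)
Lemma stable_integral_ae_lty : {ae P, forall eta : dmeasure X R, \int[eta]_x (a x)%:E < +oo}.
Proof.
pose B := [set eta : dmeasure X R | \int[eta]_x (a x)%:E = +oo].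
have mB : measurable B.
  rewrite -[B]setTI.
  exact: (mintP measurableT (emeasurable_set1 +oo)).
exists B; split => //; last first.
  move=> eta /= /negP; rewrite -leNgt leye_eq => /eqP //.
pose J := fine (\int[nu]_x (a x `^ alpha)%:E).
have J0 : (0 <= J)%R.
  by apply: fine_ge0; apply: integral_ge0 => x _; rewrite lee_fin powR_ge0.
have JE : \int[nu]_x (a x `^ alpha)%:E = J%:E.
  rewrite fineK// ge0_fin_numE//.
  by apply: integral_ge0 => x _; rewrite lee_fin powR_ge0.
have ma : measurable_fun setT (fun x => (a x `^ alpha)%:E).
  by apply/measurable_EFinP; exact: (measurableT_comp (@measurable_powR R _)).
apply/eqP; rewrite eq_le measure_ge0 andbT.
apply/lee_addgt0Pr => e e0; rewrite add0e.
have cJ0 : (0 < c * J + 1)%R by rewrite ltr_wpDl// mulr_ge0// ltW.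
(* chosen so that c J s ^ alpha <= e; adding 1 keeps the divisor nonzero when
   J = 0 *)
pose s := ((e / (c * J + 1)) `^ alpha^-1)%R.
have s0 : (0 < s)%R by rewrite powR_gt0// divr_gt0.
have sE : (s `^ alpha = e / (c * J + 1))%R.
  by rewrite -powRrM mulVf ?gt_eqF// powRr1// divr_ge0// ltW.
have IE : \int[nu]_x ((s * a x) `^ alpha)%:E = (s `^ alpha * J)%:E.
  rewrite EFinM -JE -ge0_integralZl//.
  - by apply: eq_integral => x _; rewrite (powRM _ (ltW s0) (a0 x)).
  - by move=> x _; rewrite lee_fin powR_ge0.
  - by rewrite lee_fin powR_ge0.
have msa : measurable_fun setT (fun x => (s * a x)%R) by exact: measurable_funM.
have := stableP msa (fun x => mulr_ge0 (ltW s0) (a0 x)).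
rewrite IE => /(_ (ltry _)) LE.
have : expeR (- (c%:E * (s `^ alpha * J)%:E)) <= P (~` B).
  rewrite -LE -(setIT (~` B)) -integral_indic//; last exact: measurableC.
  apply: ge0_le_integral => //.
  - by move=> eta _; exact: expeR_ge0.
  - apply: (measurableT_comp (@measurable_expeR R)).
    apply: measurableT_comp => //.
    apply: measurable_dmeasure_integral; first exact/measurable_EFinP.
    by move=> x; rewrite lee_fin (mulr_ge0 (ltW s0) (a0 x)).
  - by apply/measurable_EFinP; apply: measurable_indic; exact: measurableC.
  - move=> eta _; rewrite indicE.
    under eq_integral do rewrite EFinM.
    rewrite ge0_integralZl//; last 3 first.
    - exact/measurable_EFinP.
    - by move=> x _; rewrite lee_fin.
    - by rewrite lee_fin ltW.
    case: (boolP (eta \in _)) => [_|]; last first.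
      rewrite notin_setE/= => /contrapT ->.
      by rewrite gt0_muley ?lte_fin.
    rewrite -expeR0 lee_expeR oppe_le0.
    apply: mule_ge0; first by rewrite lee_fin ltW.
    by apply: integral_ge0 => x _; rewrite lee_fin.
rewrite (probability_setC P mB) -EFinM -EFinN /= sE => PB.
have PBfin : P B \is a fin_num by rewrite fin_num_measure.
rewrite -(fineK PBfin) in PB *.
rewrite -EFinB lee_fin in PB.
rewrite lee_fin; have := expR_ge1Dx (- (c * (e / (c * J + 1) * J))).
have : (c * (e / (c * J + 1) * J) <= e)%R.
  rewrite mulrA (mulrC c) -mulrA mulrAC ler_pdivrMr// ler_pM2l//.
  by rewrite lerDl.
move: PB; lra.
Qed.

Lemma integral_powR_1D_lty (z : R) : (0 <= z)%R ->
  \int[nu]_x ((1 + z * a x) `^ alpha)%:E < +oo.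
Proof.
move=> z0.
have ma : measurable_fun setT (fun x => (a x `^ alpha)%:E).
  by apply/measurable_EFinP; exact: (measurableT_comp (@measurable_powR R _)).
have za0 x : (0 <= z * a x)%R by rewrite mulr_ge0.
apply: (@le_lt_trans _ _ (\int[nu]_x
    ((2 `^ alpha)%:E * (1 + (z `^ alpha)%:E * (a x `^ alpha)%:E)))).
  apply: ge0_le_integral => //.
  - by move=> x _; rewrite lee_fin powR_ge0.
  - apply/measurable_EFinP; apply: (measurableT_comp (@measurable_powR R _)).
    by apply: measurable_funD => //; exact: measurable_funM.
  - apply: measurable_funeM; apply: emeasurable_funD => //.
    exact: measurable_funeM.
  - move=> x _; have := powR_1D_le (ltW alpha0) (za0 x).
    by rewrite powRM// -lee_fin.
have m1 : measurable_fun setT (fun x => (z `^ alpha)%:E * (a x `^ alpha)%:E).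
  exact: measurable_funeM.
rewrite ge0_integralZl//; last 2 first.
- exact: emeasurable_funD.
- by move=> x _; rewrite adde_ge0// mule_ge0// lee_fin powR_ge0.
rewrite lte_mul_pinfty ?lee_fin ?powR_ge0//.
rewrite ge0_integralD//; last first.
  by move=> x _; rewrite -EFinM lee_fin mulr_ge0 ?powR_ge0.
rewrite integral_cst// mul1e ge0_integralZl//; last 2 first.
- by move=> x _; rewrite lee_fin powR_ge0.
- by rewrite lee_fin powR_ge0.
apply: lte_add_pinfty; first by rewrite -ge0_fin_numE// fin_num_measure.
by rewrite lte_mul_pinfty ?lee_fin ?powR_ge0.
Qed.

(** Under the stable law this is almost surely the integral of 1 + z a with
    respect to [eta]; the two may differ where the integral of [a] is infinite, since
    [linear_functional] takes the value 0 there. *)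
Definition mass_plus (z : R) (eta : dmeasure X R) : R :=
  (total_mass eta + z * linear_functional a eta)%R.

Definition alpha_moment (z : R) : R := fine (\int[nu]_x ((1 + z * a x) `^ alpha)%:E).

Lemma alpha_momentE (z : R) : (0 <= z)%R ->
  \int[nu]_x ((1 + z * a x) `^ alpha)%:E = (alpha_moment z)%:E.
Proof.
move=> z0; rewrite /alpha_moment fineK// ge0_fin_numE ?integral_powR_1D_lty//.
by apply: integral_ge0 => x _; rewrite lee_fin powR_ge0.
Qed.

Lemma alpha_moment_ge1 (z : R) : (0 <= z)%R -> (1 <= alpha_moment z)%R.
Proof.
move=> z0; rewrite -lee_fin -alpha_momentE//.
apply: (@le_trans _ _ (\int[nu]_x (cst 1 x))).
  by rewrite integral_cst// mul1e -[X in X <= _](probability_setT nu).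
apply: ge0_le_integral => //.
- apply/measurable_EFinP; apply: (measurableT_comp (@measurable_powR R _)).
  by apply: measurable_funD => //; exact: measurable_funM.
- move=> x _; rewrite lee_fin -[leLHS](powRr0 (1 + z * a x)) ler_powR ?(ltW alpha0)//.
  by rewrite lerDl mulr_ge0.
Qed.

Lemma linear_functional_ge0 (eta : dmeasure X R) : (0 <= linear_functional a eta)%R.
Proof. by apply: fine_ge0; apply: integral_ge0 => x _; rewrite lee_fin. Qed.

Lemma mass_plus_ge_mass (z : R) (eta : dmeasure X R) : (0 <= z)%R ->
  (total_mass eta <= mass_plus z eta)%R.
Proof. by move=> z0; rewrite lerDl mulr_ge0// linear_functional_ge0. Qed.

Lemma mass_plus_ge0 (z : R) (eta : dmeasure X R) : (0 <= z)%R ->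
  (0 <= mass_plus z eta)%R.
Proof.
by move=> z0; rewrite (le_trans (total_mass_ge0 eta))// mass_plus_ge_mass.
Qed.

Lemma measurable_mass_plus (z : R) : measurable_fun setT (mass_plus z).
Proof.
apply: measurable_funD; first exact: measurable_total_mass.
by apply: measurable_funM => //; exact: measurable_linear_functional.
Qed.

(** This is the Laplace functional at t (1 + z a), whose exponent is homogeneous
    of degree [alpha] in t. *)
Lemma mass_plus_stable_laplace (z : R) : (0 <= z)%R ->
  stable_laplace P (c * alpha_moment z) alpha (mass_plus z).
Proof.
move=> z0 t t0.
have za0 x : (0 <= 1 + z * a x)%R by rewrite addr_ge0// mulr_ge0.
have m1za : measurable_fun setT (fun x => (1 + z * a x)%R).
  by apply: measurable_funD => //; exact: measurable_funM.
have mb : measurable_fun setT (fun x => (t * (1 + z * a x))%R).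
  exact: measurable_funM.
have IE : \int[nu]_x ((t * (1 + z * a x)) `^ alpha)%:E =
    (t `^ alpha * alpha_moment z)%:E.
  rewrite EFinM -alpha_momentE// -ge0_integralZl//.
  - by apply: eq_integral => x _; rewrite powRM.
  - apply/measurable_EFinP.
    exact: (measurableT_comp (@measurable_powR R _)).
  - by move=> x _; rewrite lee_fin powR_ge0.
  - by rewrite lee_fin powR_ge0.
have := stableP mb (fun x => mulr_ge0 t0 (za0 x)).
rewrite IE => /(_ (ltry _)).
rewrite -EFinM -EFinN /= (mulrC (t `^ alpha)%R) mulrA => <-.
apply: ge0_ae_eq_integral => //.
- by apply: measurable_laplace; exact: measurable_mass_plus.
- apply: (measurableT_comp (@measurable_expeR R)).
  apply: measurableT_comp => //.
  apply: measurable_dmeasure_integral; first exact/measurable_EFinP.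
  by move=> x; rewrite lee_fin mulr_ge0.
- by move=> eta _; exact: expeR_ge0.
apply: filterS stable_integral_ae_lty => eta aeta _.
have Afin : \int[eta]_x (a x)%:E \is a fin_num.
  by rewrite ge0_fin_numE// integral_ge0// => x _; rewrite lee_fin.
have Sfin : eta setT \is a fin_num by rewrite ge0_fin_numE.
have -> : \int[eta]_x (t * (1 + z * a x))%:E = (t * mass_plus z eta)%:E.
  under eq_integral do rewrite EFinM EFinD EFinM.
  rewrite ge0_integralZl//; last 2 first.
  - by apply: emeasurable_funD => //; apply: measurable_funeM; exact/measurable_EFinP.
  - by move=> x _; rewrite adde_ge0// mule_ge0// lee_fin.
  rewrite ge0_integralD//; last 2 first.
  - by move=> x _; rewrite mule_ge0// lee_fin.
  - by apply: measurable_funeM; exact/measurable_EFinP.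
  rewrite integral_cst// mul1e ge0_integralZl//; last 2 first.
  - exact/measurable_EFinP.
  - by move=> x _; rewrite lee_fin.
  by rewrite EFinM EFinD EFinM /total_mass /linear_functional /Rintegral !fineK.
by [].
Qed.

(** The case z = 0. *)
Lemma total_mass_stable_laplace : stable_laplace P c alpha (@total_mass _ X R).
Proof.
have := mass_plus_stable_laplace (lexx 0%R).
have -> : mass_plus 0 = @total_mass _ X R.
  by apply/funext => eta; rewrite /mass_plus mul0r addr0.
rewrite /alpha_moment; under eq_integral do rewrite mul0r addr0 powR1.
rewrite integral_cst// mul1e; set m := fine _.
have -> : m = 1%R by exact: (congr1 fine (probability_setT nu)).
by rewrite mulr1.
Qed.

End stable_process.

(** * Normalization and tilting *)

Lemma linear_functional_normalize d (X : measurableType d) (R : realType)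
    (a : {mfun X >-> R}) (eta : dmeasure X R) : (forall x, (0 <= a x)%R) ->
  linear_functional a (normalize eta) =
  ((total_mass eta)^-1 * linear_functional a eta)%R.
Proof.
move=> a0; rewrite /linear_functional /Rintegral -fineZ; congr fine.
apply: (@ge0_integral_mscale _ _ _ eta setT measurableT
  (NngNum (total_mass_inv_ge0 eta)) (fun x => (a x)%:E)).
- exact/measurable_EFinP.
- by move=> x _; rewrite lee_fin.
Qed.

(** Transfer to the stable law: the functional of the normalized measure is the
    ratio of the functional to the total mass, and the tilting is a density. *)
Lemma integral_normalized_tilted d (X : measurableType d) (R : realType)
    (P : probability (dmeasure X R) R) (c alpha theta : R) (a : {mfun X >-> R})
    (g : R -> R) :
  (forall x, (0 <= a x)%R) -> measurable_fun setT g ->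
  (forall u, (0 <= u)%R -> (0 <= g u)%R) ->
  \int[pushforward (normalized_tilted P c alpha theta) (linear_functional a)]_u
    (g u)%:E =
  \int[P]_eta ((g ((total_mass eta)^-1 * linear_functional a eta))%:E *
    (tilted_density c alpha theta eta)%:E).
Proof.
move=> a0 mg g0.
rewrite -[LHS]/(\int[pushforward (tilted P c alpha theta)
  (linear_functional a \o @normalize _ X R)]_u (EFin \o g) u).
have mphi : measurable_fun setT (linear_functional a \o @normalize _ X R).
  apply: measurableT_comp; first exact: measurable_linear_functional.
  exact: measurable_normalize.
rewrite integral_pushforward_total//; last exact/measurable_EFinP.
rewrite (@ge0_integral_density _ _ _ P _ (tilted_density c alpha theta))//.
- by apply: eq_integral => eta _; rewrite /= linear_functional_normalize.
- exact: measurable_tilted_density.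
- exact: tilted_density_ge0.
- by apply/measurable_EFinP; exact: (measurableT_comp mg mphi).
- by move=> eta; rewrite lee_fin g0//= linear_functional_ge0.
Qed.

Lemma integral_distribution_powR d (X : measurableType d) (R : realType)
    (nu : probability X R) (alpha z : R) (a : {mfun X >-> R}) :
  \int[distribution nu a]_u ((1 + z * u) `^ alpha)%:E =
  \int[nu]_x ((1 + z * a x) `^ alpha)%:E.
Proof.
rewrite ge0_integral_distribution//.
  apply/measurable_EFinP; apply: (measurableT_comp (@measurable_powR R _)).
  by apply: measurable_funD => //; exact: measurable_funM.
by move=> u; rewrite lee_fin powR_ge0.
Qed.

(** The normalizing constant is the inverse of the moment of order - theta of
    the total mass, which [stable_negative_moment] gives with K = c. *)
Lemma norm_const_cancel (R : realType) (c alpha theta I : R) :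
  (0 < c)%R -> (0 < I)%R ->
  (- 1 < theta)%R -> (- 1 < theta / alpha)%R ->
  (norm_const c alpha theta * (Gamma (theta / alpha + 1) / Gamma (theta + 1) *
    (c * I) `^ (- (theta / alpha))) = I `^ (- (theta / alpha)))%R.
Proof.
move=> c0 I0 th1 tha1; have G1 := Gamma_gt0 th1; have G2 := Gamma_gt0 tha1.
rewrite powRM ?ltW// (powRN c) /norm_const.
have cp : (0 < c `^ (theta / alpha))%R by rewrite powR_gt0.
by field; rewrite !gt_eqF.
Qed.

Lemma norm_const_gt0 (R : realType) (c alpha theta : R) :
  (0 < c)%R -> (- 1 < theta)%R -> (- 1 < theta / alpha)%R ->
  (0 < norm_const c alpha theta)%R.
Proof.
by move=> c0 th1 tha1; rewrite divr_gt0 ?mulr_gt0 ?powR_gt0 ?Gamma_gt0.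
Qed.

Lemma tilted_density0 d (X : measurableType d) (R : realType) (c alpha : R)
    (eta : dmeasure X R) : tilted_density c alpha 0 eta = 1%R.
Proof.
rewrite /tilted_density /norm_const mul0r !powRr0 mul1r divr1 mulfV// gt_eqF//.
by rewrite Gamma_gt0// oppr_lt0.
Qed.

Theorem theorem10 (R : realType) (d : measure_display) (X : measurableType d)
    (nu : probability X R) (c alpha theta : R)
    (P : probability (dmeasure X R) R) (a : {mfun X >-> R}) :
  standard_borel R X -> nonatomic nu ->
  (0 < c)%R -> (0 < alpha)%R -> (alpha < 1)%R -> (- alpha < theta)%R ->
  stable_law c alpha nu P ->
  (forall x, (0 <= a x)%R) ->
  \int[nu]_x (a x `^ alpha)%:E < +oo ->
  let mu_a := pushforward (normalized_tilted P c alpha theta)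
                          (linear_functional a) in
  let nu_a := distribution nu a in
  forall z : R, (0 <= z)%R ->
    (theta != 0%R ->
      (\int[mu_a]_u ((1 + z * u) `^ (- theta))%:E) `^ (- theta^-1) =
      (\int[nu_a]_u ((1 + z * u) `^ alpha)%:E) `^ (alpha^-1)) /\
    (theta = 0%R ->
      expeR (\int[mu_a]_u (alpha * ln (1 + z * u))%:E) =
      \int[nu_a]_u ((1 + z * u) `^ alpha)%:E).
Proof.
move=> _ _ c0 alpha0 alpha1 theta_gt stableP a0 a_alpha mu_a nu_a z z0.
rewrite /mu_a /nu_a integral_distribution_powR.
rewrite (alpha_momentE alpha0 a0 a_alpha z0).
set I := alpha_moment nu alpha a z.
have I1 : (1 <= I)%R by exact: alpha_moment_ge1.
have I0 : (0 < I)%R by rewrite (lt_le_trans _ I1).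
have LS := total_mass_stable_laplace c0 alpha0 stableP a0 a_alpha.
have LW := mass_plus_stable_laplace c0 alpha0 stableP a0 a_alpha z0.
rewrite -/I in LW.
have cI0 : (0 < c * I)%R by rewrite mulr_gt0.
have S0 := stable_laplace_ae_gt0 c0 alpha0 (@measurable_total_mass _ X R)
  (@total_mass_ge0 _ X R) LS.
have mW := measurable_mass_plus a z.
have W0 eta := mass_plus_ge0 a0 eta z0.
have mratio : measurable_fun setT
    (fun eta : dmeasure X R => (total_mass eta)^-1 * linear_functional a eta)%R.
  apply: measurable_funM; first by apply: measurable_funV; exact: measurable_total_mass.
  exact: measurable_linear_functional.
have ratio0 (eta : dmeasure X R) :
    (0 <= (total_mass eta)^-1 * linear_functional a eta)%R.
  by rewrite mulr_ge0 ?invr_ge0 ?total_mass_ge0 ?linear_functional_ge0.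
have ratioE (eta : dmeasure X R) : (0 < total_mass eta)%R ->
    (1 + z * ((total_mass eta)^-1 * linear_functional a eta) =
     mass_plus a z eta / total_mass eta)%R.
  by move=> Seta; rewrite /mass_plus; field; rewrite gt_eqF.
have m1z : measurable_fun setT (fun u : R => (1 + z * u)%R).
  by apply: measurable_funD => //; exact: measurable_funM.
split=> [theta0|theta0].
- have th1 : (- 1 < theta)%R by rewrite (lt_trans _ theta_gt)// ltrN2.
  have tha1 : (- 1 < theta / alpha)%R by rewrite ltr_pdivlMr// mulN1r.
  have C0 := norm_const_gt0 c0 th1 tha1.
  have mg : measurable_fun setT (fun u : R => ((1 + z * u) `^ (- theta))%R).
    exact: (measurableT_comp (@measurable_powR R _) m1z).
  have -> : \int[pushforward (normalized_tilted P c alpha theta)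
      (linear_functional a)]_u ((1 + z * u) `^ (- theta))%:E =
      (I `^ (- (theta / alpha)))%:E.
    rewrite (integral_normalized_tilted P c alpha theta a0 mg); last first.
      by move=> u _; rewrite powR_ge0.
    transitivity (\int[P]_eta ((norm_const c alpha theta)%:E *
        (mass_plus a z eta `^ (- theta))%:E)).
      apply: ge0_ae_eq_integral => //.
      + apply: emeasurable_funM; apply/measurable_EFinP.
          exact: (measurableT_comp mg mratio).
        exact: measurable_tilted_density.
      + apply: measurable_funeM; apply/measurable_EFinP.
        exact: (measurableT_comp (@measurable_powR R _) mW).
      + by move=> eta _; rewrite mule_ge0// lee_fin ?powR_ge0 ?tilted_density_ge0.
      + by move=> eta _; rewrite mule_ge0// lee_fin ?powR_ge0// ltW.
      + apply: filterS S0 => eta Seta _.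
        rewrite ratioE// -!EFinM; congr EFin.
        rewrite powRM ?invr_ge0 ?total_mass_ge0//.
        rewrite -(powR_inv1 (total_mass_ge0 eta)) -powRrM mulN1r opprK.
        rewrite /tilted_density.
        have Sth : (0 < total_mass eta `^ theta)%R by rewrite powR_gt0.
        by field; rewrite gt_eqF.
    rewrite ge0_integralZl//; last 3 first.
    + apply/measurable_EFinP.
      exact: (measurableT_comp (@measurable_powR R _) mW).
    + by move=> eta _; rewrite lee_fin powR_ge0.
    + by rewrite lee_fin ltW.
    rewrite (stable_negative_moment cI0 alpha0 th1 tha1 mW W0 LW) -EFinM.
    by rewrite norm_const_cancel.
  rewrite !poweR_EFin -powRrM; congr (_ `^ _)%:E.
  by field; rewrite theta0 gt_eqF.
- have mg : measurable_fun setT (fun u : R => (alpha * ln (1 + z * u))%R).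
    apply: measurable_funM => //.
    exact: (measurableT_comp (@measurable_ln R) m1z).
  have g0 u : (0 <= u)%R -> (0 <= alpha * ln (1 + z * u))%R.
    by move=> u0; rewrite mulr_ge0 ?(ltW alpha0)// ln_ge0// lerDl mulr_ge0.
  have mL : measurable_fun setT
      (fun eta : dmeasure X R => ln (mass_plus a z eta / total_mass eta)).
    apply: (measurableT_comp (@measurable_ln R)); apply: measurable_funM => //.
    by apply: measurable_funV; exact: measurable_total_mass.
  have SW eta := mass_plus_ge_mass a0 eta z0.
  have L0 (eta : dmeasure X R) :
      (0 <= ln (mass_plus a z eta / total_mass eta))%R.
    have [Seta|Seta] := ltP 0%R (total_mass eta).
      by rewrite ln_ge0// ler_pdivlMr// mul1r.
    by rewrite ln0// mulr_ge0_le0 ?W0 ?invr_le0.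
  rewrite theta0 (integral_normalized_tilted P c alpha 0 a0 mg g0).
  have -> : \int[P]_eta ((alpha * ln (1 + z * ((total_mass eta)^-1 *
      linear_functional a eta)))%:E * (tilted_density c alpha 0 eta)%:E) =
      \int[P]_eta (alpha%:E * (ln (mass_plus a z eta / total_mass eta))%:E).
    apply: ge0_ae_eq_integral => //.
    + apply: emeasurable_funM; apply/measurable_EFinP.
        exact: (measurableT_comp mg mratio).
      exact: measurable_tilted_density.
    + by apply: measurable_funeM; exact/measurable_EFinP.
    + move=> eta _; rewrite mule_ge0// lee_fin ?tilted_density_ge0//.
      exact: g0.
    + by move=> eta _; rewrite mule_ge0// lee_fin// ltW.
    + apply: filterS S0 => eta Seta _.
      by rewrite ratioE// tilted_density0 mule1.
  rewrite ge0_integralZl//; last 3 first.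
  + exact/measurable_EFinP.
  + by move=> eta _; rewrite lee_fin.
  + by rewrite lee_fin ltW.
  rewrite (stable_log_ratio c0 cI0 alpha0 (@measurable_total_mass _ X R) mW
    (@total_mass_ge0 _ X R) SW LS LW).
  rewrite -EFinM mulrA mulfV ?gt_eqF// mul1r (mulrC c) mulfK ?gt_eqF//=.
  by rewrite lnK.
Qed.
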